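(* Let $X\in\mathbb R^{d\times n}$ and $1\le K\le d$. The non-greedy algorithm (NGA) $U^{k+1}=\operatorname{PD}\left(X\operatorname{sgn}(X^\top U^k)\right)$ is a special instance of CondGradU applied to maximizing $F(U)=\|X^\top U\|_1$ over $\mathrm{St}(d,K)$; that is, every sequence $\{U^k\}$ generated by NGA satisfies, for all $k$, $$U^{k+1}\in\arg\max_{U\in\mathrm{St}(d,K)}\langle XS^k,U\rangle\quad\text{for some } S^k\in\partial\|V\|_1\big|_{V=X^\top U^k},\ \text{ so that } XS^k\in\partial F(U^k).$$
   Context: $\mathrm{St}(m,n)=\{U\in\mathbb R^{m\times n}: U^\top U=I\}$, $m\ge n$. $\|\cdot\|_1$ is the entrywise $L_1$-norm, $\langle\cdot,\cdot\rangle$ the Frobenius inner product, $\partial$ the convex subdifferential. $\operatorname{sgn}(x)=x/|x|$ if $x\ne0$, $\operatorname{sgn}(0)=0$, applied entrywise. Polar decomposition: for $C\in\mathbb R^{m\times n}$, $m\ge n$, a polar decomposition is $C=UH$ with $U\in\mathrm{St}(m,n)$ and $H$ symmetric positive semidefinite; $U=\operatorname{PD}(C)$ means that $U$ is such a factor. CondGradU (conditional gradient with unit step size) for maximizing a convex function $f$ over a compact set $\mathcal C$ is the scheme $\mathbf x^{k+1}\in\arg\max_{\mathbf x\in\mathcal C}\langle\boldsymbol\xi^k,\mathbf x\rangle$ with $\boldsymbol\xi^k\in\partial f(\mathbf x^k)$. *)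

(* Defs.v *)
From HB Require Import structures.
From mathcomp Require Import all_boot all_order all_algebra.
From mathcomp Require Import boolp classical_sets reals topology.
From mathcomp Require Import normedtype convex.

Set Implicit Arguments.
Unset Strict Implicit.
Unset Printing Implicit Defensive.

Import Order.TTheory GRing.Theory Num.Theory.
Import numFieldNormedType.Exports.

Local Open Scope classical_set_scope.
Local Open Scope ring_scope.

Definition St {R : realType} (m n : nat) : set 'M[R]_(m, n) :=
  [set U | U^T *m U = 1%:M].
Arguments St {R} m n _.

Definition normL1 {R : realType} {m n : nat} (A : 'M[R]_(m, n)) : R :=
  \sum_i \sum_j `|A i j|.

Definition frob {R : realType} {m n : nat} (A B : 'M[R]_(m, n)) : R :=
  \tr (A^T *m B).

Definition sgnmx {R : realType} {m n : nat} (A : 'M[R]_(m, n)) : 'M[R]_(m, n) :=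
  map_mx Num.sg A.

Definition sym_psd {R : realType} {n : nat} (H : 'M[R]_n) : Prop :=
  H^T = H /\ forall x : 'cV[R]_n, 0 <= (x^T *m H *m x) 0 0.

(* The polar factor need not be unique when C is rank deficient, so
   U = PD(C) is a relation between C and U. *)
Definition is_PD {R : realType} {m n : nat} (C U : 'M[R]_(m, n)) : Prop :=
  St m n U /\ exists2 H : 'M[R]_n, sym_psd H & C = U *m H.

Definition subdiff {R : realType} {m n : nat} (f : 'M[R]_(m, n) -> R)
    (A : 'M[R]_(m, n)) : set 'M[R]_(m, n) :=
  [set G | forall B : 'M[R]_(m, n), f A + frob G (B - A) <= f B].

Definition argmax {R : realType} {T : Type} (C : set T) (g : T -> R) : set T :=
  [set x | C x /\ forall y, C y -> g y <= g x].

(* As for NGA below, the initial point is not required to be feasible. *)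
Definition condGradU {R : realType} {m n : nat} (f : 'M[R]_(m, n) -> R)
    (C : set 'M[R]_(m, n)) (x : nat -> 'M[R]_(m, n)) : Prop :=
  [/\ convex_function setT f,
      compact C &
      forall k, exists2 xi, subdiff f (x k) xi & argmax C (frob xi) (x k.+1)].

Definition NGA {R : realType} {d n K : nat} (X : 'M[R]_(d, n))
    (U : nat -> 'M[R]_(d, K)) : Prop :=
  forall k, is_PD (X *m sgnmx (X^T *m U k)) (U k.+1).

Definition objF {R : realType} {d n K : nat} (X : 'M[R]_(d, n))
    (U : 'M[R]_(d, K)) : R :=
  normL1 (X^T *m U).

(* Main.v *)
(** If [C = W H] is a polar decomposition and [V] is another Stiefel matrix,
    then [(W - V)^T (W - V) = 2 I - W^T V - V^T W], and symmetry of [H] gives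
    [2 (<C, W> - <C, V>) = tr ((W - V) H (W - V)^T) >= 0].  Hence every polar
    factor of [C] maximizes [<C, .>] over the Stiefel manifold.  It remains to
    observe that [sgn V] is a subgradient of the entrywise L1-norm at [V], and
    that subgradients pull back along the linear map [U |-> X^T U]. *)
Require Import Defs.
From HB Require Import structures.
From mathcomp Require Import all_boot all_order all_algebra.
From mathcomp Require Import boolp classical_sets reals topology.
From mathcomp Require Import normedtype convex.
From mathcomp Require Import interval_inference lra.

Set Implicit Arguments.
Unset Strict Implicit.
Unset Printing Implicit Defensive.

Import Order.TTheory GRing.Theory Num.Theory.
Import numFieldNormedType.Exports.

Local Open Scope classical_set_scope.
Local Open Scope ring_scope.

Lemma frobE (R : realType) (m n : nat) (A B : 'M[R]_(m, n)) :
  frob A B = \sum_i \sum_j A i j * B i j.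
Proof.
rewrite /frob /mxtrace exchange_big; apply: eq_bigr => j _.
by rewrite mxE; apply: eq_bigr => i _; rewrite mxE.
Qed.

Lemma frobBr (R : realType) (m n : nat) (A B C : 'M[R]_(m, n)) :
  frob A (B - C) = frob A B - frob A C.
Proof. by rewrite /frob mulmxBr raddfB. Qed.

(** Entry by entry, [sg a * a = |a|] cancels the value at [A] and leaves [sg a * b <= |b|]. This
    holds because [|sg a|] is 0 or 1, so the convention [sg 0 = 0] does no harm. *)
Lemma subdiff_normL1_sgnmx (R : realType) (m n : nat) (A : 'M[R]_(m, n)) :
  subdiff normL1 A (sgnmx A).
Proof.
move=> B; rewrite /normL1 frobE -big_split; apply: ler_sum => i _ /=.
rewrite -big_split; apply: ler_sum => j _ /=; rewrite !mxE mulrBr -normrEsg.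
rewrite addrC subrK (le_trans (ler_norm _))// normrM normr_sg.
by case: (_ != 0); rewrite ?mul1r ?mul0r.
Qed.

Lemma subdiff_mull (R : realType) (d n K : nat) (f : 'M[R]_(n, K) -> R)
    (X : 'M[R]_(d, n)) (A : 'M[R]_(d, K)) (S : 'M[R]_(n, K)) :
  subdiff f (X^T *m A) S -> subdiff (fun U => f (X^T *m U)) A (X *m S).
Proof.
move=> fS B; apply: le_trans (fS (X^T *m B)).
by rewrite /frob trmx_mul -mulmxA mulmxBr.
Qed.

Lemma frob_mulmx_sym (R : realType) (m n : nat) (A B : 'M[R]_(m, n))
    (H : 'M[R]_n) : H^T = H -> frob (A *m H) B = frob (B *m H) A.
Proof.
move=> Hs; rewrite /frob -mxtrace_tr !trmx_mul !trmxK Hs.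
by rewrite mulmxA mxtrace_mulC mulmxA.
Qed.

(** By cyclicity this is the trace of [A *m H *m A^T], whose [i]-th diagonal entry is the quadratic
    form of [H] at the [i]-th row of [A]. *)
Lemma frob_psd_ge0 (R : realType) (m n : nat) (A : 'M[R]_(m, n)) (H : 'M[R]_n) :
  sym_psd H -> 0 <= frob (A *m H) A.
Proof.
move=> [Hs Hp]; rewrite /frob trmx_mul Hs -mulmxA mxtrace_mulC -mulmxA.
rewrite mxtrace_mulC; apply: sumr_ge0 => i _.
suff -> : (A *m H *m A^T) i i = (((row i A)^T)^T *m H *m (row i A)^T) 0 0.
  exact: Hp.
rewrite trmxK -row_mul !mxE; apply: eq_bigr => j _.
by rewrite !mxE.
Qed.

Lemma is_PD_argmax (R : realType) (m n : nat) (C W : 'M[R]_(m, n)) :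
  is_PD C W -> argmax (St m n) (frob C) W.
Proof.
move=> [Wst [H Hpsd ->]]; split=> // V Vst; have [Hs _] := Hpsd.
(* The two square terms in the expansion at [W - V] are thus equal, and only cross terms depend on
   [V]. *)
have frobSt (A : 'M[R]_(m, n)) : St m n A -> frob (A *m H) A = \tr H.
  by move=> /= AA; rewrite /frob trmx_mul -mulmxA AA mulmx1 Hs.
have := frob_psd_ge0 (W - V) Hpsd.
(* [frobBr] splits the right argument only; symmetry of the form given by [H] moves the other
   [W - V] there. *)
rewrite frobBr [frob _ W]frob_mulmx_sym// [frob _ V]frob_mulmx_sym// !frobBr.
by rewrite !frobSt// [frob (V *m H) W]frob_mulmx_sym//; lra.
Qed.

Lemma normL1D (R : realType) (m n : nat) (A B : 'M[R]_(m, n)) :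
  normL1 (A + B) <= normL1 A + normL1 B.
Proof.
rewrite /normL1 -big_split; apply: ler_sum => i _ /=.
by rewrite -big_split; apply: ler_sum => j _ /=; rewrite mxE ler_normD.
Qed.

Lemma normL1Z (R : realType) (m n : nat) (a : R) (A : 'M[R]_(m, n)) :
  normL1 (a *: A) = `|a| * normL1 A.
Proof.
rewrite /normL1 mulr_sumr; apply: eq_bigr => i _.
by rewrite mulr_sumr; apply: eq_bigr => j _; rewrite mxE normrM.
Qed.

Lemma convex_objF (R : realType) (d n K : nat) (X : 'M[R]_(d, n)) :
  convex_function setT (objF X : 'M[R]_(d, K) -> R).
Proof.
move=> t A B _ _; rewrite convRE /objF /conv /=.
rewrite mulmxDr -!scalemxAr (le_trans (normL1D _ _))// !normL1Z.
by rewrite !ger0_norm ?subr_ge0 ?ge0 ?le1.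
Qed.

(** Entries are only reindexed, so the same radius works. This carries compactness from row vectors
    to matrices. *)
Lemma vec_mx_continuous (R : numFieldType) (m n : nat) :
  continuous (vec_mx : 'rV[R]_(m * n) -> 'M[R]_(m, n)).
Proof.
move=> u A /nbhs_ballP[e /= e0 eA].
apply/nbhs_ballP; exists e => //= v [_ uv]; apply: eA; split=> // i j.
by rewrite !mxE; exact: uv.
Qed.

Lemma continuous_sum (R : numFieldType) (T : topologicalType) (I : Type)
    (r : seq I) (f : I -> T -> R) :
  (forall i, continuous (f i)) -> continuous (fun x => \sum_(i <- r) f i x).
Proof.
move=> fC x; elim: r => [|i r IHr].
  by under eq_fun do rewrite big_nil; exact: cst_continuous.
under eq_fun do rewrite big_cons.
by apply: (@continuousD R R^o T (f i)) => //; exact: fC.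
Qed.

Lemma trmx_mul_entry_continuous (R : numFieldType) (m n : nat) (i j : 'I_n) :
  continuous (fun U : 'M[R]_(m, n) => (U^T *m U) i j).
Proof.
move=> U; rewrite (_ : (fun _ => _) =
  (fun V : 'M[R]_(m, n) => \sum_k V k i * V k j)); last first.
  by apply/funext => V; rewrite mxE; apply: eq_bigr => k _; rewrite mxE.
apply: continuous_sum => k V.
by apply: continuousM; exact: coord_continuous.
Qed.

Lemma St_closed (R : realType) (m n : nat) : closed (@St R m n).
Proof.
rewrite (_ : St m n = \bigcap_(ij in [set: 'I_n * 'I_n])
  ((fun U : 'M[R]_(m, n) => (U^T *m U) ij.1 ij.2) @^-1`
     [set x | x = (1%:M : 'M[R]_n) ij.1 ij.2])).
  apply: closed_bigI => ij _; apply: preimage_closed; last exact: closed_eq.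
  by move=> U _; exact: trmx_mul_entry_continuous.
apply/seteqP; split=> U /= UU; first by move=> ij _ /=; rewrite UU.
by apply/matrixP => i j; exact: (UU (i, j)).
Qed.

(** Column [j] has unit Euclidean norm, and the square of one entry is at most the sum of
    squares. *)
Lemma St_entry_norm_le1 (R : realType) (m n : nat) (U : 'M[R]_(m, n)) i j :
  St m n U -> `|U i j| <= 1.
Proof.
move=> /matrixP/(_ j j); rewrite !mxE eqxx mulr1n => UU.
rewrite -(@expr_le1 _ 2)// real_normK ?num_real//.
rewrite -UU (bigD1 i)//= mxE -expr2 lerDl.
by apply: sumr_ge0 => k _; rewrite mxE -expr2 sqr_ge0.
Qed.

(** The Stiefel manifold is closed and lies in the image under [vec_mx] of the compact cube with
    sides [[-1, 1]]. *)
Lemma St_compact (R : realType) (m n : nat) : compact (@St R m n).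
Proof.
pose box := [set v : 'rV[R]_(m * n) |
  forall k, `[(- 1 : R), 1]%classic (v ord0 k)].
have box_compact : compact box.
  by apply: (@rV_compact _ _ (fun=> _)) => _; exact: segment_compact.
apply: (@subclosed_compact _ _ (vec_mx @` box)); first exact: St_closed.
  apply: continuous_compact box_compact.
  by apply: continuous_subspaceT; exact: vec_mx_continuous.
move=> U Ust; exists (mxvec U); last exact: mxvecK.
move=> k /=; case/mxvec_indexP: k => i j.
by rewrite mxvecE in_itv /= -ler_norml St_entry_norm_le1.
Qed.

Theorem proposition3p1 (R : realType) (d n K : nat) (X : 'M[R]_(d, n))
    (hK1 : (1 <= K)%N) (hKd : (K <= d)%N)
    (U : nat -> 'M[R]_(d, K)) (hU : NGA X U) :
  condGradU (objF X) (St d K) U /\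
  forall k, exists S : 'M[R]_(n, K),
    [/\ subdiff normL1 (X^T *m U k) S,
        subdiff (objF X) (U k) (X *m S) &
        argmax (St d K) (frob (X *m S)) (U k.+1)].
Proof.
have step k : exists S : 'M[R]_(n, K),
    [/\ subdiff normL1 (X^T *m U k) S,
        subdiff (objF X) (U k) (X *m S) &
        argmax (St d K) (frob (X *m S)) (U k.+1)].
  have sgnS := subdiff_normL1_sgnmx (X^T *m U k).
  (* With the sign matrix of the NGA update as [S], [hU k] says exactly that [U k.+1] is a polar
     factor of [X *m S]. *)
  exists (sgnmx (X^T *m U k)); split=> //; first exact: subdiff_mull.
  exact: is_PD_argmax (hU k).
split=> //; split; [exact: convex_objF|exact: St_compact|].
by move=> k; have [S [_ XS Umax]] := step k; exists (X *m S).
Qed.
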